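(* Let $K$ be a field, $S=K[x_1,\ldots,x_n]$, and let $I$ be a monomial ideal of $S$. If $\mu(I)\leq 3$, then $S/I$ is pretty clean.
   Context: For a monomial ideal $I$ of $S$, $G(I)$ denotes the unique minimal set of monomial generators of $I$, and $\mu(I)$ denotes the number of elements of $G(I)$. A monomial prime ideal is a prime ideal generated by a (possibly empty) subset of the variables. The ring $S/I$ is called pretty clean if there exists a finite chain $I=I_0\subset I_1\subset\cdots\subset I_r=S$ of monomial ideals such that $I_i/I_{i-1}\cong S/\mathfrak p_i$ for monomial prime ideals $\mathfrak p_i$ of $S$ ($1\le i\le r$), and such that for all $i<j$ for which $\mathfrak p_i\subseteq\mathfrak p_j$, it follows that $\mathfrak p_i=\mathfrak p_j$. *)

(* Defs.v *)
From HB Require Import structures.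
From mathcomp Require Import all_boot all_order all_algebra.
From mathcomp Require Import finmap.
From mathcomp Require Import mpoly.

Set Implicit Arguments.
Unset Strict Implicit.
Unset Printing Implicit Defensive.

Import GRing.Theory.
Local Open Scope ring_scope.
Local Open Scope quotient_scope.

(* A submodule is closed under opposites, but [submodClosed] does not inherit
   from [zmodClosed]; this alias restores the link. *)
Section SubmodZmod.

Variables (R : pzRingType) (V : lmodType R) (W : submodClosed V).

Definition zmod_pred : {pred V} := W.

Lemma zmod_pred_closed : zmod_closed zmod_pred.
Proof. exact: GRing.submod_closedB (GRing.submodClosedP W). Qed.

HB.instance Definition _ := GRing.isZmodClosed.Build V zmod_pred zmod_pred_closed.

End SubmodZmod.

(* [ring_quotient] provides V / W as a Z-module; the scaling is added here. *)
Section ModuleQuotient.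

Variables (R : pzRingType) (V : lmodType R) (W : submodClosed V).

Definition mquot : Type := Quotient.quot (zmod_pred W).
HB.instance Definition _ := GRing.Zmodule.on mquot.
HB.instance Definition _ := EqQuotient.on mquot.

Definition mscale (a : R) : mquot -> mquot := lift_op1 mquot ( *:%R a).

Lemma pi_mscale a : {morph \pi_mquot : x / a *: x >-> mscale a x}.
Proof.
move=> x; unlock mscale; apply/eqP; rewrite piE Quotient.equivE -scalerBr.
by rewrite [_ \in _]rpredZ // -[_ \in W]/(_ \in zmod_pred W)
  Quotient.idealrBE reprK.
Qed.

Lemma pi_madd : {morph \pi_mquot : x y / x + y}.
Proof. exact: (@Quotient.pi_add V (zmod_pred W)). Qed.

Lemma mscaleA a b (x : mquot) : mscale a (mscale b x) = mscale (a * b) x.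
Proof. by rewrite -[x]reprK -!pi_mscale scalerA. Qed.

Lemma mscale1 : left_id 1 mscale.
Proof. by move=> x; rewrite -[x]reprK -pi_mscale scale1r. Qed.

Lemma mscaleDr : right_distributive mscale +%R.
Proof.
move=> a x y; rewrite -[x]reprK -[y]reprK -pi_madd.
by rewrite -!pi_mscale -pi_madd scalerDr.
Qed.

Lemma mscaleDl (x : mquot) : {morph mscale^~ x : a b / a + b}.
Proof. by move=> a b; rewrite -[x]reprK -!pi_mscale -pi_madd scalerDl. Qed.

HB.instance Definition _ :=
  GRing.Zmodule_isLmodule.Build R mquot mscaleA mscale1 mscaleDr mscaleDl.

End ModuleQuotient.

Section Submodule.

Variables (R : pzRingType) (V : lmodType R) (A : submodClosed V).

Record submod := Submod { submod_val :> V; _ : submod_val \in A }.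

HB.instance Definition _ := [isSub for submod_val].
HB.instance Definition _ := [Choice of submod by <:].
HB.instance Definition _ := [SubChoice_isSubLmodule of submod by <:].

Variable B : submodClosed V.

Definition submod_inter : {pred submod} := [pred u | val u \in B].

Lemma submod_inter_closed : submod_closed submod_inter.
Proof.
split=> [|a u v].
  by rewrite inE; exact: rpred0.
by rewrite !inE => Bu Bv; rewrite linearP rpredD ?rpredZ.
Qed.

HB.instance Definition _ :=
  GRing.isSubmodClosed.Build R submod submod_inter submod_inter_closed.

(* A / B; meant for B contained in A. *)
Definition subquot := mquot submod_inter.
HB.instance Definition _ : GRing.Lmodule R subquot :=
  GRing.Lmodule.on (mquot submod_inter).
HB.instance Definition _ := EqQuotient.on subquot.

End Submodule.

Definition lmod_iso (R : pzRingType) (U V : lmodType R) : Prop :=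
  exists f : {linear U -> V}, bijective f.

(* An ideal is a submodule of the regular module; unlike the [idealr] of
   [ring_quotient], it may be the whole ring. *)
Notation ideal R := (submodClosed R^o).

Section Ideals.

Variable R : comNzRingType.
Implicit Types I J : ideal R.

Definition ideal_sub I J : Prop := {subset I <= J}.

Definition ideal_proper I J : Prop := ideal_sub I J /\ ~ ideal_sub J I.

Definition generated_by I (A : R -> Prop) : Prop :=
  forall f : R, f \in I <->
    exists s : seq (R * R),
      (forall c, c \in s -> A c.2) /\ f = \sum_(c <- s) c.1 * c.2.

Definition prime_ideal I : Prop := (1 : R) \notin I /\ @prime_idealr_closed R I.

End Ideals.

Section MonomialIdeals.

Variables (K : fieldType) (n : nat).
Local Notation S := {mpoly K[n]}.
Implicit Types I p : ideal S.

Definition generated_by_monomials I (G : 'X_{1..n} -> Prop) : Prop :=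
  generated_by I (fun f => exists2 m, G m & f = 'X_[m]).

Definition monomial_ideal I : Prop :=
  exists G : 'X_{1..n} -> Prop, generated_by_monomials I G.

Definition monomial_prime p : Prop :=
  prime_ideal p /\
  exists A : {set 'I_n}, generated_by p (fun f => exists2 i, i \in A & f = 'X_i).

(* "G = G(I)". By Dickson's lemma every monomial ideal has exactly one such
   finite set G, and mu(I) is its cardinal. *)
Definition minimal_monomial_generators I (G : {fset 'X_{1..n}}) : Prop :=
  generated_by_monomials I (fun m => m \in G) /\
  forall G' : {fset 'X_{1..n}}, (G' `<` G)%fset ->
    ~ generated_by_monomials I (fun m => m \in G').

(* S / I is pretty clean. [J i] is I_i for 0 <= i <= r and [p i] is p_(i+1)
   for 0 <= i < r; other indices are irrelevant. *)
Definition pretty_clean I : Prop :=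
  exists (r : nat) (J p : nat -> ideal S),
    [/\ J 0%N =i I,
        J r =i predT,
        forall i, (i <= r)%N -> monomial_ideal (J i),
        forall i, (i < r)%N ->
          [/\ ideal_proper (J i) (J i.+1),
              monomial_prime (p i)
            & @lmod_iso S (subquot (J i.+1) (J i)) (mquot (p i))]
      & forall i j, (i < j < r)%N -> ideal_sub (p i) (p j) -> p i =i p j].

End MonomialIdeals.

(* Main.v *)
From HB Require Import structures.
Require Import Defs.
From mathcomp Require Import all_boot all_order all_algebra.
From mathcomp Require Import finmap.
From mathcomp Require Import zify mpoly.

(* A chain of monomial ideals with quotients S/p_i amounts to adding monomials
   u_i one at a time, with (current ideal) : u_i = p_i. A chain for L : f,
   shifted by f, followed by one for (L, f), is a chain for L; it stays pretty
   when all primes of the second chain have height h and all primes over L : f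
   have height at least h.

   Three reductions of this kind suffice. Taking for f a variable dividing a
   generator, complete intersections on k generators have a chain with all
   primes of height k. Taking for f the gcd of all generators, (L, f) = (f) has
   primes of height 1 and L : f has trivial gcd. Finally, if gcd(u, v, w) = 1
   and f = gcd(v, w), then (u, v, w) + (f) = (u, f) is a complete intersection
   of height 2, while (u, v, w) : f = (u, v/f, w/f) contains two coprime
   monomials, so its primes have height at least 2; doing this for each of the
   three pairs leaves a complete intersection. *)

Set Implicit Arguments.
Unset Strict Implicit.
Unset Printing Implicit Defensive.

Import GRing.Theory.
Local Open Scope ring_scope.
Local Open Scope quotient_scope.

(** * Monomial ideals and chains of ideals, through exponent vectors *)

Section Exponents.

Variable n : nat.
Local Notation mon := 'X_{1..n}.
Implicit Types (L M : seq mon) (A B : {set 'I_n}) (c : seq (mon * {set 'I_n})).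
Implicit Types (f g m u v w : mon).

(** The exponents of the monomials lying in the ideal generated by [L]. *)
Definition up L : pred mon := fun m => has (fun g => (g <= m)%MM) L.

(** Subtraction is truncated, so [g - f] is the exponent of g / gcd(g, f), and the list generates L
    : f. *)
Definition colon L f := [seq (g - f)%MM | g <- L].

(** Says that the monomial x^m lies in the prime generated by the variables of [A]. *)
Definition meets A m := [exists i in A, m i != 0%N].

Definition vars A := [seq U_(i)%MM | i <- enum A] : seq mon.

Lemma up_cat L M m : up (L ++ M) m = up L m || up M m.
Proof. exact: has_cat. Qed.

Lemma up_cons g L m : up (g :: L) m = (g <= m)%MM || up L m.
Proof. by []. Qed.

Lemma up_le L m m' : (m <= m')%MM -> up L m -> up L m'.
Proof.
move=> le_mm' /hasP[g gL le_gm]; apply/hasP.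
by exists g => //; apply: lepm_trans le_mm'.
Qed.

Lemma lepm_subl f g m : (g - f <= m)%MM = (g <= m + f)%MM.
Proof.
apply/mnm_lepP/mnm_lepP => le i; have := le i;
  by rewrite mnmBE mnmDE leq_subLR addnC.
Qed.

Lemma up_colon L f m : up (colon L f) m = up L (m + f)%MM.
Proof. by rewrite /up has_map; apply: eq_has => g /=; rewrite lepm_subl. Qed.

Lemma lep1m i m : (U_(i) <= m)%MM = (m i != 0%N).
Proof.
apply/mnm_lepP/idP => [/(_ i)|mi k]; first by rewrite mnm1E eqxx lt0n.
by rewrite mnm1E; case: eqP => // <-; rewrite lt0n.
Qed.

Lemma up_vars A m : up (vars A) m = meets A m.
Proof.
rewrite /up has_map; apply/hasP/exists_inP => -[i].
  by rewrite mem_enum /= lep1m; exists i.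
by move=> iA mi; exists i; rewrite ?mem_enum //= lep1m.
Qed.

Lemma meets_var A i : meets A U_(i)%MM = (i \in A).
Proof.
apply/exists_inP/idP => [[j jA]|iA]; last by exists i; rewrite ?mnm1E ?eqxx.
by rewrite mnm1E; case: (i =P j) => [->|].
Qed.

Lemma meetsU1 i A m : meets (i |: A) m = (m i != 0%N) || meets A m.
Proof.
apply/exists_inP/orP => [[j /setU1P[->|jA] mj]|[mi|/exists_inP[j jA mj]]].
- by left.
- by right; apply/exists_inP; exists j.
- by exists i => //; exact: setU11.
- by exists j => //; rewrite setU1r.
Qed.

(* [filt L c] with [c = [:: (u_1, A_1); ...; (u_r, A_r)]] encodes the chain
   I_i = (L, u_1, ..., u_i), with I_r = S and
   I_(i-1) : u_i = (x_k, k \in A_i). *)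
Fixpoint filt L c : Prop :=
  if c is (u, A) :: c' then
    (forall m, up L (m + u)%MM = meets A m) /\ filt (u :: L) c'
  else up L 0%MM.

Lemma filt_ext L M c : up L =1 up M -> filt L c -> filt M c.
Proof.
elim: c L M => [|[u A] c IHc] L M eqLM /=; first by rewrite eqLM.
case=> col Lc; split=> [m|]; first by rewrite -eqLM.
by apply: IHc Lc => m; rewrite /up /= [has _ L]eqLM.
Qed.

(** L lies in every I_(i-1), hence in I_(i-1) : u_i, which is the i-th prime. *)
Lemma filt_meets L c A : filt L c -> A \in unzip2 c -> all (meets A) L.
Proof.
elim: c L => [//|[u B] c IHc] L /= [col Lc]; rewrite inE => /predU1P[->|Ac].
  apply/allP=> g gL; rewrite -col; apply/hasP; exists g => //.
  exact: lem_addr.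
by have /= /andP[] := IHc _ Lc Ac.
Qed.

(** Multiplying the first chain by f keeps its primes, since J : (u f) = (J : f) : u. It leads from
    L to (L, f), where the second chain takes over. *)
Lemma filt_cat L f c1 c2 :
    filt (colon L f) c1 -> filt (f :: L) c2 ->
  filt L ([seq ((x.1 + f)%MM, x.2) | x <- c1] ++ c2).
Proof.
elim: c1 L => [|[u A] c1 IHc] L /=.
  (* The colon ideal is S, so f already lies in the ideal and adjoining it changes nothing. *)
  rewrite up_colon add0m => Lf; apply: filt_ext => m /=.
  by apply/orb_idl => /up_le; apply.
case=> col Lc1 Lc2; split=> [m|]; first by rewrite addmA -up_colon.
apply: IHc; first by rewrite /= addmK.
(* The generator [u + f] is a multiple of f, hence redundant next to f. *)
apply: filt_ext Lc2 => m /=; rewrite orbA; congr (_ || _); apply/esym/orb_idr.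
by move/(lepm_trans _); apply; apply: lem_addl.
Qed.

(** * Pretty chains, and chains whose primes all have the same height *)

Definition pretty_gens L : Prop :=
  exists2 c, filt L c &
    pairwise (fun A B => (A \subset B) ==> (A == B)) (unzip2 c).

(** The size of [A] is the height of the prime generated by its variables. *)
Definition pure_gens L (h : nat) : Prop :=
  exists2 c, filt L c & all (fun A => #|A| == h) (unzip2 c).

Lemma pretty_ext L M : up L =1 up M -> pretty_gens L -> pretty_gens M.
Proof. by move=> eqLM [c /(filt_ext eqLM) Mc pc]; exists c. Qed.

Lemma pure_ext L M h : up L =1 up M -> pure_gens L h -> pure_gens M h.
Proof. by move=> eqLM [c /(filt_ext eqLM) Mc pc]; exists c. Qed.

Lemma unzip2_shift f c : unzip2 [seq ((x.1 + f)%MM, x.2) | x <- c] = unzip2 c.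
Proof. by rewrite /unzip2 -map_comp; apply: eq_map. Qed.

Lemma pure_split L f h :
  pure_gens (colon L f) h -> pure_gens (f :: L) h -> pure_gens L h.
Proof.
case=> c1 Lc1 h1 [c2 Lc2 h2].
exists ([seq ((x.1 + f)%MM, x.2) | x <- c1] ++ c2).
  exact: filt_cat.
by rewrite /unzip2 map_cat all_cat [map _ _]unzip2_shift h1.
Qed.

(* A prime of S/(L : f) has height >= h, so it is contained in a height-h
   prime of S/(L, f) only if the two are equal. *)
Lemma pretty_split L f h :
    pretty_gens (colon L f) -> pure_gens (f :: L) h ->
    (forall A, all (meets A) (colon L f) -> (h <= #|A|)%N) ->
  pretty_gens L.
Proof.
case=> c1 Lc1 pw1 [c2 Lc2 h2] geh.
exists ([seq ((x.1 + f)%MM, x.2) | x <- c1] ++ c2); first exact: filt_cat.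
rewrite [unzip2 _]map_cat [map _ [seq _ | x <- c1]]unzip2_shift -/(unzip2 c2).
rewrite pairwise_cat pw1 /=.
(* Serves for pairs across the two chains and for pairs inside the second. *)
have hle A B : (h <= #|A|)%N -> B \in unzip2 c2 -> (A \subset B) ==> (A == B).
  move=> leA /(allP h2)/eqP hB; apply/implyP => sAB.
  by rewrite eqEcard sAB hB.
apply/andP; split.
  apply/allrelP => A B Ac1 Bc2; apply: hle Bc2.
  exact/geh/(filt_meets Lc1).
elim: (unzip2 c2) h2 hle => //= B s IHs /andP[/eqP hB hs] hle.
apply/andP; split; last first.
  by apply: IHs => // A C lA Cs; apply: hle; rewrite // inE Cs orbT.
by apply/allP => C Cs; apply: hle; rewrite ?hB // inE Cs orbT.
Qed.

(** Between sets of equal size, inclusion forces equality. *)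
Lemma pure_pretty L h : pure_gens L h -> pretty_gens L.
Proof.
case=> c Lc hc; exists c => //.
elim: (unzip2 c) hc => //= A s IHs /andP[/eqP hA hs]; rewrite IHs // andbT.
apply/allP => B /(allP hs)/eqP hB; apply/implyP => sAB.
by rewrite eqEcard sAB hA hB leqnn.
Qed.

(** * Complete intersections *)

Definition mcoprime : rel mon :=
  fun u v => [forall i, (u i == 0%N) || (v i == 0%N)].

Lemma mcoprime_sub u v u' v' :
  (u' <= u)%MM -> (v' <= v)%MM -> mcoprime u v -> mcoprime u' v'.
Proof.
move=> /mnm_lepP leu /mnm_lepP lev /forallP co; apply/forallP => i.
have := co i; have := leu i; have := lev i; rewrite -!leqn0.
by move=> l1 l2 /orP[/(leq_trans l2)|/(leq_trans l1)] ->; rewrite ?orbT.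
Qed.

Lemma subm_coprime u i : u i = 0%N -> (u - U_(i))%MM = u.
Proof.
move=> ui; apply/mnmP => k; rewrite mnmBE mnm1E.
by case: eqP => [<-|_]; rewrite ?ui ?subn0.
Qed.

(** Keeping variables apart from [L] makes the induction close: for x_i dividing u, the colon by x_i
    lowers the degree of u, while adjoining x_i absorbs u and moves i into [A]. *)
Lemma pure_ci L A :
    pairwise mcoprime L -> {in L, forall g, ~~ meets A g} ->
  pure_gens (L ++ vars A) (size L + #|A|).
Proof.
elim: L A => [|u L IHL] A /= coL avL.
  exists [:: (0%MM, A)]; rewrite /= ?eqxx //; split=> [m|].
    by rewrite addm0 up_vars.
  by rewrite lepm_refl.
have [k] := ubnP (mdeg u); elim: k => // k IHk in u A coL avL *.
have /andP[cou coL'] := coL; have avL' g : g \in L -> ~~ meets A g.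
  by move=> gL; apply: avL; rewrite inE gL orbT.
rewrite ltnS => degu; have [->|u_neq0] := eqVneq u 0%MM.
  (* For u = 1 the ideal is S, and the empty chain is pure of any height. *)
  by exists [::] => //=; rewrite lepm_refl.
have [i ui]: exists i, u i != 0%N.
  apply/existsP; apply: contraR u_neq0; rewrite negb_exists => /forallP u0.
  by apply/eqP/mnmP => i; rewrite mnm0E; apply/eqP; rewrite -[_ == _]negbK.
have Li g : g \in L -> g i = 0%N.
  by move=> /(allP cou)/forallP/(_ i); rewrite (negPf ui) => /eqP.
have Au : ~~ meets A u by apply: avL; rewrite mem_head.
have iA : i \notin A by apply: contra Au => iA; apply/exists_inP; exists i.
(* By coprimality with u, and since i is not in [A], x_i divides no other generator. *)
have colonE : colon (u :: L ++ vars A) U_(i) = (u - U_(i))%MM :: L ++ vars A.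
  rewrite /colon /=; congr (_ :: _); apply: map_id_in => g.
  rewrite mem_cat => /orP[/Li/subm_coprime //|/mapP[j jA ->]].
  apply: subm_coprime; rewrite mnm1E; case: eqP => // ji.
  by move: jA; rewrite mem_enum ji (negPf iA).
apply: (@pure_split _ U_(i)%MM).
  rewrite colonE; apply: IHk.
  - rewrite coL' andbT; apply: sub_all cou => g.
    by apply: mcoprime_sub; rewrite ?lem_subr ?lepm_refl.
  - move=> g; rewrite inE => /predU1P[->|/avL' //].
    apply: contra Au => /exists_inP[j jA]; rewrite mnmBE => uj.
    by apply/exists_inP; exists j => //; apply: contra uj => /eqP->.
  - apply: leq_trans degu; rewrite -{2}(@submK _ U_(i)%MM u) ?lep1m //.
    by rewrite mdegD mdeg1 addn1.
(* The absorbed generator u is counted again as the new variable: [iA] turns the summand 1 into the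
   one of [cardsU1]. *)
rewrite addSnnS -add1n -[1%N]/(nat_of_bool true) -iA -cardsU1.
apply: pure_ext (IHL (i |: A) coL' _) => [m|g gL]; last first.
  by rewrite meetsU1 negb_or Li //= avL'.
rewrite !up_cons !up_cat !up_vars meetsU1 lep1m orbCA.
case: eqVneq => //= mi; case: mnm_lepP => // /(_ i).
by rewrite mi leqn0 (negPf ui).
Qed.

Lemma pure_coprime L : pairwise mcoprime L -> pure_gens L (size L).
Proof.
move=> coL; have := pure_ci (A := set0) coL.
rewrite cards0 addn0 /vars enum_set0 cats0; apply=> g _.
by apply/existsP=> -[i]; rewrite inE.
Qed.

(** * Gcds, and ideals with at most three generators *)

Definition mgcd u v := [multinom minn (u i) (v i) | i < n].

Lemma mgcdE u v i : mgcd u v i = minn (u i) (v i).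
Proof. exact: mnmE. Qed.

Lemma mgcdC u v : mgcd u v = mgcd v u.
Proof. by apply/mnmP=> i; rewrite !mgcdE minnC. Qed.

Lemma mgcd_lel u v : (mgcd u v <= u)%MM.
Proof. by apply/mnm_lepP=> i; rewrite mgcdE geq_minl. Qed.

Lemma mgcd_ler u v : (mgcd u v <= v)%MM.
Proof. by rewrite mgcdC mgcd_lel. Qed.

Lemma mgcdP u v : mcoprime (u - mgcd u v)%MM (v - mgcd u v)%MM.
Proof.
apply/forallP=> i; rewrite !mnmBE !mgcdE -!leqn0 !leq_subLR !addn0 !leq_min.
by rewrite !leqnn andbT leq_total.
Qed.

Lemma meets_card1 A u : meets A u -> (0 < #|A|)%N.
Proof. by case/exists_inP=> i iA _; apply/card_gt0P; exists i. Qed.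

(** A variable dividing u does not divide v, so the variables found for u and v differ. *)
Lemma meets_card2 A u v :
  mcoprime u v -> meets A u -> meets A v -> (1 < #|A|)%N.
Proof.
move=> /forallP co /exists_inP[i iA ui] /exists_inP[j jA vj].
apply/card_gt1P; exists i, j; split=> //; apply: contraNneq vj => <-.
by have := co i; rewrite (negPf ui).
Qed.

(** With d = gcd(u, v), the colon by d is generated by two coprime monomials, and (d, u, v) =
    (d). *)
Lemma pretty2 u v : pretty_gens [:: u; v].
Proof.
set d := mgcd u v; apply: (@pretty_split _ d 1%N) => /=.
- by apply: (@pure_pretty _ 2); apply: pure_coprime; rewrite /= mgcdP.
- apply: pure_ext (@pure_coprime [:: d] isT) => m; rewrite !up_cons.
  case: (boolP (d <= m)%MM) => //= ndm; apply/esym/norP.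
  split; last rewrite orbF; apply: contra ndm; apply: lepm_trans.
    exact: mgcd_lel.
  exact: mgcd_ler.
- by move=> A /andP[/meets_card1].
Qed.

(* When gcd(u, v, w) = 1 and d = gcd(v, w), (u, v, w) + (d) is the complete
   intersection (d, u). *)
Lemma pretty3_split u v w (d := mgcd v w) :
    (forall i, [|| u i == 0, v i == 0 | w i == 0]%N) ->
  pretty_gens [:: u; (v - d)%MM; (w - d)%MM] -> pretty_gens [:: u; v; w].
Proof.
move=> g1; have cdu : mcoprime d u.
  apply/forallP=> i; have := g1 i; rewrite mgcdE -!leqn0 geq_min.
  by case/or3P=> ->; rewrite ?orbT.
have ud : (u - d)%MM = u.
  apply/mnmP=> i; rewrite mnmBE; have /forallP/(_ i)/orP[] := cdu.
    by move/eqP->; rewrite subn0.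
  by move/eqP->.
move=> pd; apply: (@pretty_split _ d 2%N) => /=; rewrite ?ud //.
- have: pairwise mcoprime [:: d; u] by rewrite /= cdu.
  move/pure_coprime; apply: pure_ext => m; rewrite !up_cons.
  case: (boolP (d <= m)%MM) => //= ndm; congr (_ || _); apply/esym/norP.
  split; last rewrite orbF; apply: contra ndm; apply: lepm_trans.
    exact: mgcd_lel.
  exact: mgcd_ler.
- by move=> A /and4P[_ Av Aw _]; apply: meets_card2 Av Aw; apply: mgcdP.
Qed.

Lemma pretty3_rot u v w : pretty_gens [:: v; w; u] -> pretty_gens [:: u; v; w].
Proof. by apply: pretty_ext => m; rewrite !up_cons !orbF orbA orbC. Qed.

(** Each pair is divided by its gcd in turn. Passing to divisors preserves coprimality and the
    trivial common gcd, so after three rounds all pairs are coprime. *)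
Lemma pretty3_gcd1 u v w :
    (forall i, [|| u i == 0, v i == 0 | w i == 0]%N) ->
  pretty_gens [:: u; v; w].
Proof.
move=> g1; apply: pretty3_split => //; set d := mgcd v w.
have {g1}: forall i, [|| u i == 0, (v - d)%MM i == 0 | (w - d)%MM i == 0]%N.
  move=> i; have := g1 i; rewrite !mnmBE.
  by case/or3P=> /eqP->; rewrite ?sub0n ?eqxx ?orbT.
move: (mgcdP v w); rewrite -/d.
(* The quotients take over the names v and w; only their coprimality and the trivial gcd are
   kept. *)
move: {v w d}(v - d)%MM (w - d)%MM => v w cvw g1.
apply/pretty3_rot/pretty3_split => [i|]; first by rewrite orbA orbC g1.
set d := mgcd w u.
have {}g1: forall i, [|| (u - d)%MM i == 0, v i == 0 | (w - d)%MM i == 0]%N.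
  move=> i; have := g1 i; rewrite !mnmBE.
  by case/or3P=> /eqP->; rewrite ?sub0n ?eqxx ?orbT.
have {}cvw : mcoprime v (w - d)%MM.
  by apply: mcoprime_sub cvw; rewrite ?lem_subr ?lepm_refl.
move: (mgcdP w u) g1 cvw; rewrite -/d.
move: {w u d}(w - d)%MM (u - d)%MM => w u cwu g1 cvw.
apply/pretty3_rot/pretty3_split => [i|]; first by rewrite orbC -orbA g1.
set d := mgcd u v.
apply: (@pure_pretty _ 3); apply: pure_coprime; rewrite /= mgcdP !andbT.
apply/andP; split.
  by apply: mcoprime_sub cwu; rewrite ?lem_subr ?lepm_refl.
apply: (mcoprime_sub (lepm_refl w) (lem_subr v d)).
by apply/forallP=> i; rewrite orbC; apply/forallP: i.
Qed.

Lemma pretty3 u v w : pretty_gens [:: u; v; w].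
Proof.
set d := mgcd u (mgcd v w); apply: (@pretty_split _ d 1%N) => /=.
(* In each coordinate some exponent attains the minimum, so one of the three differences is 0. *)
- apply: pretty3_gcd1 => i; rewrite !mnmBE -!leqn0 !leq_subLR !addn0 !mgcdE.
  by lia.
- apply: pure_ext (@pure_coprime [:: d] isT) => m; rewrite !up_cons.
  case: (boolP (d <= m)%MM) => //= ndm; apply/esym/norP; rewrite orbF.
  have dgcd := mgcd_ler u (mgcd v w); split; last (apply/norP; split);
    apply: contra ndm; apply: lepm_trans.
  + exact: mgcd_lel.
  + exact: lepm_trans dgcd (mgcd_lel v w).
  + exact: lepm_trans dgcd (mgcd_ler v w).
- by move=> A /andP[/meets_card1].
Qed.

Lemma pretty_le3 L : (size L <= 3)%N -> pretty_gens L.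
Proof.
case: L => [|u [|v [|w [|]]]] // _; last exact: pretty3.
- exact: pure_pretty (@pure_coprime [::] isT).
- exact: pure_pretty (@pure_coprime [:: u] isT).
- exact: pretty2.
Qed.

End Exponents.

(** * Monomial ideals and monomial primes of the polynomial ring *)

Section Algebra.

Variables (K : fieldType) (n : nat).
Local Notation S := {mpoly K[n]}.
Local Notation mon := 'X_{1..n}.
Implicit Types (L : seq mon) (A : {set 'I_n}) (m u : mon) (f a : S).

(** A polynomial lies in a monomial ideal exactly when the monomials of its support do; this makes
    membership a boolean test. *)
Definition mideal L : {pred S^o} := [pred f : S | all (up L) (msupp f)].

Lemma midealP L f :
  reflect (forall m, f@_m != 0 -> up L m) (f \in mideal L).
Proof.
apply: (iffP allP) => Lf m; first by rewrite -mcoeff_msupp; apply: Lf.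
by rewrite mcoeff_msupp; apply: Lf.
Qed.

Lemma mideal_closed L : @submod_closed S S^o (mideal L).
Proof.
split=> [|a f g /allP Lf /allP Lg]; first by rewrite inE msupp0.
apply/allP=> m /msuppD_le; rewrite mem_cat => /orP[|/Lg //].
case/msuppM_le/allpairsP=> -[m1 m2] [_ /Lf Lm2 ->].
exact: up_le (lem_addl _ _) Lm2.
Qed.

HB.instance Definition _ L :=
  GRing.isSubmodClosed.Build S S^o (mideal L) (mideal_closed L).

Lemma mpolyX_mideal L m : (('X_[m] : S) \in mideal L) = up L m.
Proof. by rewrite inE msuppX /= andbT. Qed.

Lemma mideal_sub L M : {subset up L <= up M} -> {subset mideal L <= mideal M}.
Proof. by move=> sLM f; apply: sub_all. Qed.

Lemma mideal_mul L a f : f \in mideal L -> a * f \in mideal L.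
Proof.
have [L0 Lc] := mideal_closed L.
by move=> Lf; rewrite -[a * f]addr0; apply: Lc.
Qed.

Lemma generated_mideal (I : ideal S) L :
  generated_by_monomials I (fun m => m \in L) <-> I =i mideal L.
Proof.
have mono : generated_by_monomials (mideal L : ideal S) (fun m => m \in L).
  move=> f; split=> [/allP Lf | [s [sL ->]]]; last first.
    rewrite big_seq; apply: rpred_sum => c /sL[m mL ->]; apply: mideal_mul.
    by rewrite mpolyX_mideal; apply/hasP; exists m; rewrite ?lepm_refl.
  (* The first generator dividing m; the default is never reached on the support of f. *)
  pose g m := nth 0%MM L (find (fun g => g <= m)%MM L).
  have gL m : m \in msupp f -> g m \in L /\ (g m <= m)%MM.
    move=> /Lf Lm; split; last exact: nth_find Lm.
    by rewrite mem_nth // -has_find.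
  exists [seq (f@_m *: 'X_[m - g m], 'X_[g m]) | m <- msupp f]; split.
    by move=> c /mapP[m /gL[gmL _] ->]; exists (g m).
  rewrite big_map {1}[f]mpolyE big_seq [RHS]big_seq.
  apply: eq_bigr => m /gL[_ gm].
  by rewrite /= -scalerAl -mpolyXD submK.
(* Generators determine the ideal, so [mono] settles both directions. *)
split=> [genI f|eqI f]; last by rewrite eqI; apply: mono.
by apply/idP/idP=> [/genI/mono|/mono/genI].
Qed.

Lemma monomial_mideal L : monomial_ideal (mideal L : ideal S).
Proof. by exists (fun m => m \in L); apply/generated_mideal. Qed.

(* Setting the variables of [A] to 0 is a ring morphism whose kernel is the
   ideal they generate. *)
Definition kill A : n.-tuple S := [tuple if i \in A then 0 else 'X_i | i < n].

Lemma kill_mon A m :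
  ('X_[m] : S) \mPo kill A = if meets A m then 0 else 'X_[m].
Proof.
rewrite comp_mpolyX; case: ifPn => [/exists_inP[i iA mi]|Am].
  by rewrite (bigD1 i) //= tnth_mktuple iA expr0n (negPf mi) mul0r.
rewrite [RHS]mpolyXE_id; apply: eq_bigr => i _; rewrite tnth_mktuple.
case: ifP => // iA; suff ->: m i = 0%N by [].
by apply: contraNeq Am => mi; apply/exists_inP; exists i.
Qed.

(** The terms outside the ideal survive unchanged; their monomials are distinct, so they cannot
    cancel. *)
Lemma kill_eq0 A f : (f \mPo kill A == 0) = (f \in mideal (vars A)).
Proof.
have killE : f \mPo kill A = \sum_(m <- msupp f | ~~ meets A m) f@_m *: 'X_[m].
  rewrite {1}[f]mpolyE raddf_sum [RHS]big_mkcond; apply: eq_bigr => m _ /=.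
  by rewrite comp_mpolyZ kill_mon; case: ifP; rewrite ?scaler0.
rewrite killE -big_filter -msupp_eq0; apply/eqP/allP => [supp0 m fm|Af].
  rewrite up_vars; apply: contraT => Am.
  suff: m \in [::] by [].
  rewrite -supp0 (perm_mem (msupp_sumX _ _)) ?filter_uniq ?msupp_uniq //.
    by rewrite mem_filter Am.
  by move=> k; rewrite mem_filter => /andP[_]; rewrite mcoeff_msupp.
rewrite (@eq_in_filter _ _ pred0) ?filter_pred0 ?big_nil ?msupp0 // => m /Af.
by rewrite up_vars => ->.
Qed.

Lemma monomial_prime_vars A : monomial_prime (mideal (vars A) : ideal S).
Proof.
split; first split.
- rewrite -mpolyX0 mpolyX_mideal up_vars; apply/exists_inP=> -[i _].
  by rewrite mnm0E.
(* The kernel of a morphism into an integral domain is prime. *)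
- by move=> f g; rewrite -!kill_eq0 rmorphM mulf_eq0.
- have /generated_mideal gen :
    (mideal (vars A) : ideal S) =i mideal (vars A) by [].
  exists A => f.
  split=> [/gen[s [sA ->]]|[s [sA ->]]].
    exists s; split=> // c /sA[m /mapP[i]]; rewrite mem_enum => iA -> ->.
    by exists i.
  apply/gen; exists s; split=> // c /sA[i iA ->]; exists U_(i)%MM => //.
  by apply/mapP; exists i; rewrite ?mem_enum.
Qed.

End Algebra.

(** * Isomorphisms of quotient modules *)

Lemma mquotE (R : pzRingType) (V : lmodType R) (W : submodClosed V) (x y : V) :
  (\pi_(mquot W) x == \pi_(mquot W) y) = (x - y \in W).
Proof. by rewrite piE Quotient.equivE. Qed.

Section QuotientIso.

Variables (R : pzRingType) (V V' : lmodType R).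

(** First isomorphism theorem: [phi] pulls W' back to W and is onto modulo W', so it induces a
    bijection V/W -> V'/W', whose inverse is the map sought. *)
Lemma mquot_iso (W : submodClosed V) (W' : submodClosed V')
    (phi : {linear V -> V'}) :
    (forall v, (phi v \in W') = (v \in W)) ->
    (forall v', exists v, v' - phi v \in W') ->
  lmod_iso (mquot W') (mquot W).
Proof.
move=> kerphi surphi; pose g (x : mquot W) := \pi_(mquot W') (phi (repr x)).
have gpi v : g (\pi_(mquot W) v) = \pi_(mquot W') (phi v).
  by apply/eqP; rewrite /g mquotE -linearB kerphi -mquotE reprK.
have g_lin : linear g.
  move=> a x y; rewrite -[x]reprK -[y]reprK.
  rewrite -[a *: _]pi_mscale -[_ + _]pi_madd !gpi linearP.
  by rewrite [LHS]pi_madd [X in X + _]pi_mscale.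
have g_inj : injective g.
  move=> x y; rewrite -[x]reprK -[y]reprK !gpi => /eqP.
  by rewrite mquotE -linearB kerphi -mquotE => /eqP.
have g_sur y : exists x, g x == y.
  have [v Wv] := surphi (repr y); exists (\pi_(mquot W) v).
  by rewrite gpi -[y in _ == y]reprK eq_sym mquotE.
(* The inverse is picked by choice; it is linear because [g] is linear and injective. *)
pose h y := xchoose (g_sur y).
have hK : cancel h g by move=> y; apply/eqP/(xchooseP (g_sur y)).
have gK : cancel g h by move=> x; apply: g_inj; rewrite hK.
have h_lin : linear h by move=> a x y; apply: g_inj; rewrite g_lin !hK.
pose hL : {linear mquot W' -> mquot W} :=
  HB.pack h (GRing.isLinear.Build _ _ _ _ h h_lin).
by exists hL, g.
Qed.

End QuotientIso.

(** * From chains of exponents to prime filtrations *)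

Section Filtration.

Variables (K : fieldType) (n : nat).
Local Notation S := {mpoly K[n]}.
Local Notation mon := 'X_{1..n}.
Implicit Types (L : seq mon) (A : {set 'I_n}) (m u : mon) (f a : S).

Section Mulm.

Variables (L : seq mon) (u : mon).

Lemma mulm_subproof a : a * 'X_[u] \in mideal (u :: L).
Proof. by apply: mideal_mul; rewrite mpolyX_mideal up_cons lepm_refl. Qed.

Definition mulm (a : S^o) : submod (mideal (u :: L)) :=
  Submod (mulm_subproof a).

Lemma mulm_is_linear : linear mulm.
Proof. by move=> a f g; apply: val_inj; rewrite /= mulrDl -mulrA. Qed.

HB.instance Definition _ :=
  GRing.isLinear.Build S S^o (submod (mideal (u :: L))) _ mulm mulm_is_linear.

End Mulm.

(** Multiplication by x^u induces S/(L : u) -> (L, u)/L. *)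
Lemma subquot_iso L u A :
    (forall m, up L (m + u)%MM = meets A m) ->
  @lmod_iso S (subquot (mideal (u :: L)) (mideal L)) (mquot (mideal (vars A))).
Proof.
move=> col; apply: (@mquot_iso _ _ _ _ _ (mulm L u)) => [a|[f Lf]].
  rewrite inE /=; apply/midealP/midealP => La m.
    by rewrite up_vars -col => am; apply: La; rewrite addmC mcoeffMX.
  rewrite -mcoeff_msupp (perm_mem (msuppMX _ _)) => /mapP[k ka ->].
  by rewrite addmC col -up_vars; apply: La; rewrite -mcoeff_msupp.
(* The terms of f divisible by x^u, divided by it; the other terms of f must lie in L. *)
pose q : S := \sum_(m <- msupp f | (u <= m)%MM) f@_m *: 'X_[m - u].
exists q; suff: f - q * 'X_[u] \in mideal L by [].
have ->: f - q * 'X_[u] = \sum_(m <- msupp f | ~~ (u <= m)%MM) f@_m *: 'X_[m].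
  rewrite {1}[f]mpolyE (bigID (fun m => u <= m)%MM) /= mulr_suml addrAC.
  rewrite -sumrB big1 ?add0r // => m um.
  by rewrite -scalerAl -mpolyXD submK // subrr.
rewrite big_seq_cond; apply: rpred_sum => m /andP[fm um].
rewrite -mul_mpolyC; apply: mideal_mul; rewrite mpolyX_mideal.
by have := allP Lf m fm; rewrite up_cons (negPf um).
Qed.

(** Generators of I_i; [catrev] pushes the u_k onto [L] in the order of [filt]. *)
Definition stage L (c : seq (mon * {set 'I_n})) i :=
  catrev (take i (unzip1 c)) L.

Lemma filt_stage L c i : filt L c -> (i < size c)%N ->
  exists2 u, stage L c i.+1 = u :: stage L c i &
    forall m, up (stage L c i) (m + u)%MM = meets (nth set0 (unzip2 c) i) m.
Proof.
elim: c L i => [//|[u A] c IHc] L [|i] /= [col Lc] ic; last exact: IHc.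
by exists u => //; rewrite /stage /= take0.
Qed.

Lemma filt_stage_last L c : filt L c -> up (stage L c (size c)) 0%MM.
Proof. by elim: c L => [//|[u A] c IHc] L /= [_ /IHc]. Qed.

Lemma filt_pretty_clean L (I : ideal S) c :
    I =i mideal L -> filt L c ->
    pairwise (fun A B => (A \subset B) ==> (A == B)) (unzip2 c) ->
  pretty_clean I.
Proof.
move=> IL Lc pw; exists (size c), (fun i => mideal (stage L c i) : ideal S).
exists (fun i => mideal (vars (nth set0 (unzip2 c) i)) : ideal S); split.
- by move=> f; rewrite IL /stage take0.
- move=> f; apply/allP=> m _; apply: up_le (filt_stage_last Lc).
  by apply/mnm_lepP=> i; rewrite mnm0E.
- by move=> i _; apply: monomial_mideal.
- move=> i ic; have [u -> col] := filt_stage Lc ic.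
  split; [split | exact: monomial_prime_vars | exact: subquot_iso].
    by apply: mideal_sub => m Lm; rewrite [_ \in _]up_cons [up _ m]Lm orbT.
  (* If x^u lay in I_i, then 1 would lie in the prime I_i : u. *)
  move/(_ 'X_[u]); rewrite !mpolyX_mideal up_cons lepm_refl => /(_ isT).
  rewrite -[u in up _ u]add0m col => /exists_inP[k _].
  by rewrite mnm0E.
- move=> i j /andP[ij jc] sij f; set A := nth _ _ i; set B := nth _ _ j.
  suff -> : A = B by [].
  (* An inclusion of primes is read off on the variables. *)
  have sAB : A \subset B.
    apply/subsetP=> k kA; have := sij 'X_k; rewrite !mpolyX_mideal !up_vars.
    by rewrite !meets_var; apply.
  move/(pairwiseP set0): pw => /(_ i j).
  rewrite !inE size_map => /(_ (ltn_trans ij jc) jc ij).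
  by rewrite -/A -/B sAB => /eqP.
Qed.

End Filtration.

Theorem corollary2p6 (K : fieldType) (n : nat) (I : ideal {mpoly K[n]})
    (G : {fset 'X_{1..n}}) :
  monomial_ideal I ->
  minimal_monomial_generators I G ->
  (#|` G| <= 3)%N ->
  pretty_clean I.
Proof.
move=> _ [genG _] /pretty_le3[c Gc pw].
apply: filt_pretty_clean Gc pw; exact/generated_mideal.
Qed.
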